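(* Let $G$ be a graph, $H$ a graph and $v\in V(H)$. (i) If $H\in\mathbf{W}_2$, then $G(H,v)$ belongs to $\mathbf{W}_1$ (i.e., is well-covered). (ii) If $H\in\mathbf{W}_3$, then $G(H,v)$ belongs to $\mathbf{W}_2$.
   Context: Graphs are finite, simple, undirected, with non-empty vertex sets. An independent set is a set of pairwise non-adjacent vertices; a maximum independent set is one of largest size. For a positive integer $n$, a graph belongs to the class $\mathbf{W}_n$ if every $n$ pairwise disjoint independent sets are included, respectively, in $n$ pairwise disjoint maximum independent sets; $\mathbf{W}_1$ is exactly the class of well-covered graphs (all maximal independent sets have the same size). The $G$-concatenation $G(H,v)$ of $H$ on the vertex $v$ is the graph obtained from $G$ by taking, for each vertex $u$ of $G$, a separate copy of $H$ and identifying $u$ with the copy of $v$ in that copy of $H$. *)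

(* Defs.v *)
From mathcomp Require Import all_boot.

Set Implicit Arguments.
Unset Strict Implicit.
Unset Printing Implicit Defensive.

Record sgraph := SGraph {
  vertex :> finType;
  adj : rel vertex;
  adj_sym : symmetric adj;
  adj_irrefl : irreflexive adj;
  vertex_gt0 : 0 < #|vertex|
}.

Definition independent (G : sgraph) (A : {set G}) : Prop :=
  forall x y : G, x \in A -> y \in A -> ~~ adj x y.

Definition maximum_independent (G : sgraph) (S : {set G}) : Prop :=
  independent S /\ forall T : {set G}, independent T -> #|T| <= #|S|.

Definition maximal_independent (G : sgraph) (S : {set G}) : Prop :=
  independent S /\
  forall T : {set G}, independent T -> S \subset T -> T = S.

Definition pairwise_disjoint (G : sgraph) (n : nat) (A : 'I_n -> {set G}) :
  Prop := forall i j : 'I_n, i != j -> [disjoint A i & A j].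

(* The class W_n, for n > 0. Disjointness is that of an indexed family, so
   the empty set may occur several times among the A i. *)
Definition in_W (n : nat) (G : sgraph) : Prop :=
  forall A : 'I_n -> {set G},
    (forall i, independent (A i)) -> pairwise_disjoint A ->
    exists S : 'I_n -> {set G},
      [/\ forall i, maximum_independent (S i),
          pairwise_disjoint S
        & forall i, A i \subset S i].

Definition well_covered (G : sgraph) : Prop :=
  forall S T : {set G},
    maximal_independent S -> maximal_independent T -> #|S| = #|T|.

Section Concatenation.

Variables (G H : sgraph) (v : H).

(* The vertex (u, x) is the vertex x of the copy of H attached to u; the
   vertex u of G, identified with the copy of v, is thus (u, v). *)
Definition concat_adj (a b : G * H) : bool :=
  (a.1 == b.1) && adj a.2 b.2 || [&& a.2 == v, b.2 == v & adj a.1 b.1].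

Lemma concat_adj_sym : symmetric concat_adj.
Proof.
move=> a b; rewrite /concat_adj eq_sym (adj_sym a.2) (adj_sym a.1).
by rewrite (andbCA (a.2 == v)).
Qed.

Lemma concat_adj_irrefl : irreflexive concat_adj.
Proof. by move=> a; rewrite /concat_adj !adj_irrefl !andbF. Qed.

Lemma concat_vertex_gt0 : 0 < #|{: G * H}|.
Proof. by rewrite card_prod muln_gt0 !vertex_gt0. Qed.

Definition concatenation : sgraph :=
  SGraph concat_adj_sym concat_adj_irrefl concat_vertex_gt0.

End Concatenation.

Lemma independentP (G : sgraph) (A : {set G}) :
  reflect (independent A) [forall x in A, forall y in A, ~~ adj x y].
Proof.
apply: (iffP idP) => [/forall_inP h x y xA yA|h].
  by have /forall_inP := h x xA; apply.
by apply/forall_inP=> x xA; apply/forall_inP=> y yA; apply: h.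
Qed.

Lemma independent_sub_maximal (G : sgraph) (A : {set G}) :
  independent A -> exists2 S : {set G}, maximal_independent S & A \subset S.
Proof.
move=> /independentP Ai.
have [S /maxsetP[/independentP Si Smax] AS] :=
  maxset_exists (P := fun B : {set G} =>
    [forall x in B, forall y in B, ~~ adj x y]) Ai.
by exists S => //; split=> // T /independentP Ti ST; apply: Smax.
Qed.

Lemma in_W1_well_covered (G : sgraph) : in_W 1 G <-> well_covered G.
Proof.
split=> [GW|GW A Ai _].
  suff mx (S : {set G}) : maximal_independent S -> maximum_independent S.
    move=> S T /mx[Si Sm] /mx[Ti Tm].
    by apply/eqP; rewrite eqn_leq Sm // Tm.
  move=> [Si Sm].
  have [|i j|S' [S'm _ SS']] := GW (fun=> S); first by [].
    by rewrite (ord1 i) (ord1 j) eqxx.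
  have S'mx := S'm ord0.
  by rewrite -(Sm (S' ord0) _ (SS' ord0)) //; case: S'mx.
have [S Sm AS] := independent_sub_maximal (Ai ord0).
exists (fun=> S); split=> [i|i j|i]; last by rewrite (ord1 i).
  split; first by case: Sm.
  move=> T /independent_sub_maximal[T' T'm TT'].
  by rewrite (GW S T') // subset_leq_card.
by rewrite (ord1 i) (ord1 j) eqxx.
Qed.

(* Main.v *)
Require Import Defs.
From mathcomp Require Import all_boot.

Set Implicit Arguments.
Unset Strict Implicit.
Unset Printing Implicit Defensive.

(** If [H] is in W_{n+1}, the extra independent set can be spent on [v]: in each
    copy of [H], the [n] given traces extend to disjoint maximum independent
    sets none of which gains the vertex [v].  Since the edges of [G] only join
    copies of [v], the unions of these extensions over all copies stay
    independent, and their size, [#|G|] times the independence number of [H],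
    is the largest possible. *)

Section Fibers.

Variables (G H : sgraph) (v : H).

Definition fiber (T : {set concatenation G v}) (u : G) : {set H} :=
  [set x | (u, x) \in T].

Lemma card_fibers (T : {set concatenation G v}) :
  #|T| = \sum_(u : G) #|fiber T u|.
Proof.
under eq_bigr do rewrite -sum1_card.
rewrite -sum1_card pair_big_dep /=.
by apply: eq_bigl => -[u x]; rewrite inE.
Qed.

Lemma fiber_independent (T : {set concatenation G v}) (u : G) :
  independent T -> independent (fiber T u).
Proof.
move=> Ti x y; rewrite !inE => xT yT.
by have := Ti _ _ xT yT; rewrite /= /concat_adj /= eqxx negb_or => /andP[].
Qed.

End Fibers.

(** Whichever of the $n+1$ disjoint maximum sets receives [v], the others are barred from it. So it
    suffices that [v] is claimed in advance, either by some [A j] or by the additional set. *)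
Lemma in_W_extend_avoiding (n : nat) (H : sgraph) (v : H)
    (A : 'I_n -> {set H}) :
  in_W n.+1 H -> (forall i, independent (A i)) -> pairwise_disjoint A ->
  exists S : 'I_n -> {set H},
    [/\ forall i, maximum_independent (S i), pairwise_disjoint S,
        forall i, A i \subset S i & forall i, v \in S i -> v \in A i].
Proof.
move=> HW Ai Ad.
(* [B] is $\{v\}$ if no [A i] contains [v], and empty otherwise; it is thus independent and disjoint
   from every [A i] in both cases. It takes the last index [ord_max] of the enlarged family. *)
pose B : {set H} := [set x | (x == v) && [forall i, x \notin A i]].
pose A' (k : 'I_n.+1) := if unlift ord_max k is Some i then A i else B.
have A'l i : A' (lift ord_max i) = A i by rewrite /A' liftK.
have A'm : A' ord_max = B by rewrite /A' unlift_none.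
have AB i : [disjoint A i & B].
  rewrite disjoint_sym disjoints_subset; apply/subsetP=> x.
  by rewrite !inE => /andP[_ /forallP].
have [k|k l|S [Sm Sd AS]] := HW A'.
- case: (unliftP ord_max k) => [i|] ->; rewrite ?A'l ?A'm // => x y.
  by rewrite !inE => /andP[/eqP-> _] /andP[/eqP-> _]; rewrite adj_irrefl.
- case: (unliftP ord_max k) => [i|] ->; case: (unliftP ord_max l) => [j|] ->;
    rewrite ?A'l ?A'm ?eqxx //.
  + by rewrite (inj_eq lift_inj); apply: Ad.
  + by rewrite disjoint_sym.
exists (fun i => S (lift ord_max i)); split=> [i|i j ij|i|i vS].
- exact: Sm.
- by apply: Sd; rewrite (inj_eq lift_inj).
- by rewrite -A'l.
(* Otherwise [v] would lie both in [S ord_max] and in the set [S (lift ord_max i)] disjoint from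
   it. *)
have vB : v \notin B.
  apply/negP=> vB; have := AS ord_max; rewrite A'm => /subsetP/(_ v vB) vm.
  have /Sd/disjointFr/(_ vS) : lift ord_max i != ord_max.
    by rewrite eq_sym neq_lift.
  by rewrite vm.
(* Hence some [A j] already owns [v], and disjointness of the extensions forces [j = i]. *)
move: vB; rewrite inE eqxx /= negb_forall => /existsP[j]; rewrite negbK => vAj.
have [<- //|ij] := eqVneq j i.
have := AS (lift ord_max j); rewrite A'l => /subsetP/(_ v vAj) vSj.
have /Sd/disjointFr/(_ vSj) : lift ord_max j != lift ord_max i.
  by rewrite (inj_eq lift_inj).
by rewrite vS.
Qed.

(** The argument is uniform in [n]; the two claims are the cases $n=1$ and $n=2$. *)
Theorem concatenation_in_W (n : nat) (G H : sgraph) (v : H) :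
  in_W n.+1 H -> in_W n (concatenation G v).
Proof.
move=> HW A Ai Ad.
have ext u : exists S : {ffun 'I_n -> {set H}},
    [/\ forall i, maximum_independent (S i), pairwise_disjoint S,
        forall i, fiber (A i) u \subset S i
      & forall i, v \in S i -> v \in fiber (A i) u].
  have [i|i j /Ad ij|S [Sm Sd AS vS]] :=
    @in_W_extend_avoiding _ _ v (fun i => fiber (A i) u) HW.
  - exact: fiber_independent.
  - rewrite disjoints_subset; apply/subsetP=> x; rewrite !inE => xA.
    by rewrite (disjointFr ij xA).
  exists (finfun S); split=> [i|i j ij|i|i]; rewrite !ffunE //.
  - exact: Sd.
  - exact: vS.
have {ext} [S Sp] := fin_all_exists ext.
pose U i : {set concatenation G v} := [set a | a.2 \in S a.1 i].
have fiberU i u : fiber (U i) u = S u i by apply/setP=> x; rewrite !inE.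
exists U; split=> [i|i j ij|i].
- split=> [[u x] [w y]|T Ti].
    rewrite !inE /= => xS yS.
    rewrite /concat_adj /= negb_or; apply/andP; split.
      apply/negP=> /andP[/eqP uw]; rewrite -{w}uw in yS.
      by have [/(_ i)[Si _] _ _ _] := Sp u; apply/negP/Si.
    (* An edge coming from [G] has ends [(u, v)] and [(w, v)]. Since the extensions gain no copy of
       [v], both ends were already in [A i], which is independent. *)
    apply/negP=> /and3P[/eqP xv /eqP yv uw]; rewrite {x}xv in xS.
    rewrite {y}yv in yS.
    have [_ _ _ /(_ i xS)] := Sp u; have [_ _ _ /(_ i yS)] := Sp w.
    rewrite !inE => wA uA; have := Ai i _ _ uA wA.
    by rewrite /= /concat_adj /= !eqxx uw orbT.
  (* Maximality is checked copy by copy: each fiber of [T] is independent in [H], hence no larger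
     than the maximum set [S u i]. *)
  rewrite !card_fibers; apply: leq_sum => u _; rewrite fiberU.
  by have [/(_ i)[_ Sm] _ _ _] := Sp u; apply/Sm/fiber_independent.
- rewrite disjoints_subset; apply/subsetP=> -[u x]; rewrite !inE /= => xS.
  by have [_ /(_ i j ij)/disjointFr/(_ xS)-> _ _] := Sp u.
- apply/subsetP=> -[u x] xA; rewrite inE /=.
  by have [_ _ /(_ i)/subsetP/(_ x) + _] := Sp u; apply; rewrite inE.
Qed.

Theorem theorem4p11 (G H : sgraph) (v : H) :
  (in_W 2 H -> in_W 1 (concatenation G v)) /\
  (in_W 3 H -> in_W 2 (concatenation G v)).
Proof. by split; apply: concatenation_in_W. Qed.
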